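(* Let $k$ and $n\ge1$ be positive integers with $k\nmid n$. For every $\pi\in S_{n-1}$ and every $x\in\{1,\dots,n\}$, the number of $k$-cycles of $\pi$ equals the number of $k$-cycles of $\phi_k(\pi,x)\in S_n$.
   Context: A $k$-cycle is a cycle of length exactly $k$. For a finite set $A$ of positive integers, a permutation $\sigma$ of $A$ is written in canonical cycle notation $\sigma=c^{(t)}\cdots c^{(1)}$, where each cycle $c^{(i)}=(c^{(i)}_1\cdots c^{(i)}_{\ell_i})$ starts with its largest element and $c^{(t)}_1<\cdots<c^{(1)}_1$ (so $c^{(1)}$, the rightmost cycle, contains the largest element of $A$); the empty permutation $\emptyset$ has $t=0$. Mutually recursive maps are defined: $\phi_k$ takes $(\sigma,x)$ with $\sigma$ a permutation of $A$ and $x\notin A$ and returns a permutation of $A\cup\{x\}$; $\psi_k$ takes a permutation of a nonempty set $B$ and returns a pair $(\sigma,y)$ with $y\in B$ and $\sigma$ a permutation of $B\setminus\{y\}$. Inputs are always written in canonical cycle notation, writing $c_j=c^{(1)}_j$, $\ell_1$ for the length of $c^{(1)}$, and $(\pi',x')=\psi_k(c^{(t)}\cdots c^{(2)})$ where used; the first applicable case is used. Define $\phi_k(\emptyset,x)=(x)$, and for nonempty $\sigma$: (a) if $x>c_1$: $\phi_k(\sigma,x)=c^{(t)}\cdots c^{(1)}(x)$; (b) if $\ell_1=k$: $\phi_k(\sigma,x)=\phi_k(c^{(t)}\cdots c^{(2)},c_2)\,(c_1c_3\cdots c_kx)$; (c) if $\ell_1=k-1$ and $t>1$: $\phi_k(\sigma,x)=\pi'(c_1x'c_2\cdots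 c_{k-1}x)$; (d) otherwise $\phi_k(\sigma,x)=c^{(t)}\cdots c^{(2)}(c_1\cdots c_{\ell_1}x)$. For nonempty $\sigma$: (a) if $\ell_1=1$: $\psi_k(\sigma)=(c^{(t)}\cdots c^{(2)},c_1)$; (b) if $\ell_1=k+1$: $\psi_k(\sigma)=(\phi_k(c^{(t)}\cdots c^{(2)},c_2)(c_1c_3\cdots c_k),\,c_{k+1})$; (c) if $\ell_1=k$ and $t>1$: $\psi_k(\sigma)=(\pi'(c_1x'c_2\cdots c_{k-1}),\,c_k)$; (d) otherwise $\psi_k(\sigma)=(c^{(t)}\cdots c^{(2)}(c_1\cdots c_{\ell_1-1}),\,c_{\ell_1})$. For $\pi\in S_{n-1}$ and $x\in\{1,\dots,n\}$, $\phi_k(\pi,x)\in S_n$ is obtained by replacing every letter $j\ge x$ of $\pi$ by $j+1$ and then applying $\phi_k$ above with inserted letter $x$. *)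

(* Defs.v *)
From mathcomp Require Import all_boot all_order all_fingroup.

Set Implicit Arguments.
Unset Strict Implicit.
Unset Printing Implicit Defensive.

(* Canonical cycle notation c^(t) ... c^(1) is encoded from right to left, as  *)
(* the sequence [:: c^(1); ...; c^(t)]: every cycle starts with its largest   *)
(* letter and these first letters decrease along the sequence. Letters range  *)
(* over an arbitrary totally ordered type.                                    *)
(*   psi k s is None when s is [::], so that the test t > 1 of case (c) is    *)
(* psi k s' being Some. An empty cycle never occurs in a notation, and the    *)
(* branch of phi where c^(1) has length k but no second letter needs k = 1.   *)
Fixpoint phi {d : Order.disp_t} {T : orderType d} (k : nat)
    (s : seq (seq T)) (x : T) {struct s} : seq (seq T) :=
  match s with
  | (c1 :: c) :: s' =>
    if (c1 < x)%O then [:: x] :: s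
    else if (size c).+1 == k then
      if c is c2 :: c3 then (c1 :: rcons c3 x) :: phi k s' c2
      else (c1 :: rcons c x) :: s'
    else if (size c).+2 == k then
      if psi k s' is Some (p', x') then (c1 :: x' :: rcons c x) :: p'
      else (c1 :: rcons c x) :: s'
    else (c1 :: rcons c x) :: s'
  | _ => [:: [:: x]]
  end
with psi {d : Order.disp_t} {T : orderType d} (k : nat)
    (s : seq (seq T)) {struct s} : option (seq (seq T) * T) :=
  match s with
  | [:: c1] :: s' => Some (s', c1)
  | (c1 :: c2 :: c3) :: s' =>
    if (size c3).+2 == k.+1 then
      Some (belast c1 c3 :: phi k s' c2, last c2 c3)
    else if (size c3).+2 == k then
      if psi k s' is Some (p', x') then
        Some ((c1 :: x' :: belast c2 c3) :: p', last c2 c3)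
      else Some (belast c1 (c2 :: c3) :: s', last c2 c3)
    else Some (belast c1 (c2 :: c3) :: s', last c2 c3)
  | _ => None
  end.

Definition cycle_notation (n : nat) (p : 'S_n) : seq (seq 'I_n) :=
  [seq fingraph.orbit p i | i <- rev (enum 'I_n)
                          & [forall j in porbit p i, j <= i]].

(* The cycle c_1 -> c_2 -> ... -> c_l -> c_1; products of permutations are    *)
(* evaluated from left to right.                                              *)
Definition cycle_perm (T : finType) (c : seq T) : {perm T} :=
  if c is c1 :: c' then (\prod_(j <- c') tperm c1 j)%g else 1%g.

Definition perm_of_cycles (T : finType) (s : seq (seq T)) : {perm T} :=
  (\prod_(c <- s) cycle_perm c)%g.

(* S_n acts on {0, ..., n-1}; lift x sends j to j + 1 if x <= j, and to j     *)
(* otherwise.                                                                 *)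
Definition phi_perm (k n : nat) (p : 'S_n.-1) (x : 'I_n) : 'S_n :=
  perm_of_cycles (phi k (map (map (lift x)) (cycle_notation p)) x).

Definition num_cycles (k : nat) (T : finType) (p : {perm T}) : nat :=
  #|[set C in porbits p | #|C| == k]|.

(* Main.v *)
Require Import Defs.
From mathcomp Require Import all_boot all_order all_fingroup.
From mathcomp Require Import zify.

(* Each canonical notation is tracked only through its letters and its cycle
   lengths: by a simultaneous induction on phi and psi, the letters change by
   exactly the inserted or removed one and the number of cycles of length k is
   constant unless k divides the larger number of letters; neither fact
   depends on the order of the letters. *)

Lemma count_belast_last (T : Type) (a : pred T) (x : T) (s : seq T) :
  count a (belast x s) + a (last x s) = a x + count a s.
Proof. by rewrite -[RHS]/(count a (x :: s)) lastI -cats1 count_cat /= addn0. Qed.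

(** Every case only moves letters between cycles, so comparing counts of an arbitrary predicate
    turns it into linear arithmetic. Absence of empty cycles is carried along because both maps
    return default values on an empty cycle; the [None] clause makes the test [t > 1] exact. *)
Lemma phi_psi_perm_eq (d : Order.disp_t) (T : orderType d) (k : nat)
    (s : seq (seq T)) :
  1 < k -> [::] \notin s ->
  (forall x, perm_eq (flatten (phi k s x)) (x :: flatten s)
             /\ [::] \notin phi k s x)
  /\ (if psi k s is Some (s', y)
      then perm_eq (y :: flatten s') (flatten s) /\ [::] \notin s'
      else s = [::]).
Proof.
move=> k_gt1; elim: s => [_|c s IHs]; first by split.
rewrite inE negb_or => /andP[c_neq0 /[dup] s_neq0 /IHs[IHphi IHpsi]].
case: c c_neq0 => // c1 c _; split=> [x|] /=.
  case: ifP => _; first by rewrite !inE s_neq0.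
  case: eqP => [sz_c|_].
    (* Case (b): [1 < k] provides the second letter [c2]. *)
    case: c sz_c => [|c2 c3] /= sz_c; first by lia.
    have [/seq.permP eq_phi phi_neq0] := IHphi c2; split; last by rewrite inE.
    apply/seq.permP => a; have := eq_phi a.
    rewrite /= !count_cat -cats1 count_cat /=; lia.
  (* Plain appending, shared by case (d) and by length [k - 1] with [t = 1]. *)
  have perm_d : perm_eq ((c1 :: rcons c x) ++ flatten s)
                        (x :: (c1 :: c) ++ flatten s).
    by apply/seq.permP => a; rewrite /= !count_cat -cats1 count_cat /=; lia.
  case: eqP => _; last by rewrite inE.
  case: (psi k s) IHpsi => [[s' y] [/seq.permP eq_psi s'_neq0]|_]; last by rewrite inE.
  split; last by rewrite inE.
  apply/seq.permP => a; have := eq_psi a.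
  rewrite /= !count_cat -cats1 count_cat /=; lia.
case: c => [|c2 c3] //=.
have perm_d : perm_eq (last c2 c3 :: (c1 :: belast c2 c3) ++ flatten s)
                      (c1 :: c2 :: c3 ++ flatten s).
  apply/seq.permP => a; have := count_belast_last _ a c2 c3.
  by rewrite /= !count_cat /=; lia.
case: eqP => [sz_c|_].
  case: c3 sz_c {perm_d} => [|c4 c5] /= sz_c; first by lia.
  have [/seq.permP eq_phi phi_neq0] := IHphi c2; split; last by rewrite inE.
  apply/seq.permP => a; have := eq_phi a; have := count_belast_last _ a c4 c5.
  rewrite /= !count_cat /=; lia.
case: eqP => _; last by rewrite inE.
case: (psi k s) IHpsi => [[s' y] [/seq.permP eq_psi s'_neq0]|_]; last by rewrite inE.
split; last by rewrite inE.
apply/seq.permP => a; have := eq_psi a; have := count_belast_last _ a c2 c3.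
rewrite /= !count_cat /=; lia.
Qed.

Lemma dvdn_eq_addr (k m n : nat) : m = n + k -> (k %| m) = (k %| n).
Proof. by move=> ->; rewrite dvdn_addl. Qed.

(* The only steps that can change the number of k-cycles are a single cycle growing
   from length k - 1 to k, or shrinking back; both need a total of k letters.
   The number of letters drops by exactly k in every recursive call. *)
Lemma phi_psi_count (d : Order.disp_t) (T : orderType d) (k : nat)
    (s : seq (seq T)) :
  1 < k -> [::] \notin s ->
  (~~ (k %| (size (flatten s)).+1) -> forall x,
     count [pred c | size c == k] (phi k s x) = count [pred c | size c == k] s)
  /\ (~~ (k %| size (flatten s)) ->
      if psi k s is Some (s', _)
      then count [pred c | size c == k] s' = count [pred c | size c == k] s
      else s = [::]).
Proof.
move=> k_gt1; elim: s => [_|c s IHs]; first by split=> //= _ _; case: eqP => //; lia.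
rewrite inE negb_or => /andP[c_neq0 /[dup] s_neq0 /IHs[IHphi IHpsi]].
have [_ psi0] := phi_psi_perm_eq _ _ _ _ k_gt1 s_neq0.
case: c c_neq0 => // c1 c _; split=> /= kN => [x|].
  case: ifP => _ /=; first by case: eqP => //; lia.
  case: eqP => [sz_c|sz_c].
    case: c sz_c kN => [|c2 c3] /= sz_c kN; first by lia.
    rewrite size_rcons sz_c eqxx IHphi //.
    by move: kN; rewrite (dvdn_eq_addr _ _ (size (flatten s)).+1) // size_cat; lia.
  case: eqP => sz_c' /=; last by rewrite size_rcons; case: eqP => //; lia.
  have kNs : ~~ (k %| size (flatten s)).
    by move: kN; rewrite (dvdn_eq_addr _ _ (size (flatten s))) // size_cat; lia.
  case: (psi k s) psi0 (IHpsi kNs) => [[s' y] _ <-|s0 _] /=.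
    by rewrite size_rcons; case: eqP => //; lia.
  by move: kN; rewrite s0 /= cats0 sz_c' dvdnn.
case: c kN => [|c2 c3] /= kN; first by case: eqP => //; lia.
case: eqP => [sz_c|sz_c].
  (* The first cycle shrinks from length [k + 1] to [k - 1], and neither is counted. *)
  rewrite /= size_belast IHphi; first by do 2 (case: eqP => //); lia.
  by move: kN; rewrite (dvdn_eq_addr _ _ (size (flatten s)).+1) // size_cat; lia.
case: eqP => sz_c' /=; last by rewrite size_belast; case: eqP => //; lia.
have kNs : ~~ (k %| size (flatten s)).
  by move: kN; rewrite (dvdn_eq_addr _ _ (size (flatten s))) // size_cat; lia.
case: (psi k s) psi0 (IHpsi kNs) => [[s' y] _ <-|s0 _] /=.
  by rewrite size_belast; case: eqP => //; lia.
by move: kN; rewrite s0 /= cats0 sz_c' dvdnn.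
Qed.

(** * Counting cycles of a permutation from a list of its cycles *)

Lemma porbit_orbit (T : finType) (p : {perm T}) (x : T) :
  porbit p x =i fingraph.orbit p x.
Proof.
move=> y; rewrite -fconnect_orbit; apply/porbitP/idP => [[i ->]|].
  by rewrite permX fconnect_iter.
by move=> /iter_findex <-; exists (findex p x y); rewrite permX.
Qed.

(** Sending a listed cycle to its set of letters is a length-preserving bijection from [s] onto the
    orbits of [p]. *)
Lemma num_cycles_count (k : nat) (T : finType) (p : {perm T}) (s : seq (seq T)) :
  [::] \notin s -> uniq (flatten s) -> flatten s =i T -> all (fcycle p) s ->
  num_cycles k p = count [pred c | size c == k] s.
Proof.
move=> s_neq0 Us sT /allP s_cycle.
pose S := [seq [set x in c] | c : seq T <- [seq c <- s | size c == k]].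
have Uc c : c \in s -> uniq c.
  elim: s Us {s_neq0 sT s_cycle S} => //= c' s IHs.
  rewrite cat_uniq => /and3P[Uc' _ /IHs {}IHs].
  by rewrite inE => /predU1P[->|].
have porbit_c c x : c \in s -> x \in c -> porbit p x = [set y in c].
  move=> cs xc; apply/setP => y; rewrite inE porbit_orbit.
  by rewrite -fconnect_orbit (fconnect_cycle (s_cycle _ cs) xc).
have US : uniq S.
  rewrite /S; elim: s s_neq0 Us {sT s_cycle S Uc porbit_c} => //= c s IHs.
  rewrite inE negb_or cat_uniq => /andP[c_neq0 /IHs {}IHs].
  move=> /and3P[_ /hasPn cNs /IHs Us].
  case: ifP => //= _; rewrite {}Us andbT; apply/mapP => -[c'].
  rewrite mem_filter => /andP[_ c's] /setP eq_cc'.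
  (* Injectivity: the head of the nonempty [c] would also lie in the later cycle [c'], against
     disjointness. *)
  case: c c_neq0 cNs eq_cc' => // x c _ cNs /(_ x); rewrite !inE eqxx => /esym xc'.
  have /cNs : x \in flatten s by apply/flattenP; exists c'.
  by rewrite /= mem_head.
rewrite /num_cycles -size_filter -(size_map (fun c : seq T => [set x in c])) -/S.
rewrite -(card_uniqP US); apply: eq_card => C; rewrite !inE.
apply/andP/mapP => [[/imsetP[x _ ->]]|[c]].
  have /flattenP[c cs xc] : x \in flatten s by rewrite sT.
  rewrite (porbit_c c) // cardsE (card_uniqP (Uc c cs)) => sz_c.
  by exists c; rewrite ?mem_filter ?sz_c.
rewrite mem_filter => /andP[sz_c cs] ->.
rewrite cardsE (card_uniqP (Uc c cs)); split=> //; apply/imsetP.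
case: c cs sz_c => [|x c] cs _; first by rewrite (negPf s_neq0) in cs.
by exists x; rewrite // (porbit_c (x :: c)) // mem_head.
Qed.

(** * Products of disjoint cycles *)

Lemma cycle_perm_out (T : finType) (c : seq T) (x : T) :
  x \notin c -> cycle_perm c x = x.
Proof.
case: c => [|c1 c] /=; first by rewrite perm1.
rewrite inE negb_or => /andP[x_c1]; elim: c => [|c2 c IHc]; first by rewrite big_nil perm1.
rewrite inE negb_or big_cons permM => /andP[x_c2 /IHc].
by rewrite tpermD // eq_sym.
Qed.

(** A path applies its function at every vertex except the final one, [y]. *)
Lemma eq_fpath_rcons (T : eqType) (f g : T -> T) (x y : T) (s : seq T) :
  {in x :: s, f =1 g} -> fpath f x (rcons s y) = fpath g x (rcons s y).
Proof.
elim: s x => [|z s IHs] x eq_fg /=; first by rewrite eq_fg ?mem_head.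
by rewrite eq_fg ?mem_head // IHs // => t zs; rewrite eq_fg // inE zs orbT.
Qed.

Lemma eq_fcycle_in (T : eqType) (f g : T -> T) (s : seq T) :
  {in s, f =1 g} -> fcycle f s = fcycle g s.
Proof. by case: s => //= x s; apply: eq_fpath_rcons. Qed.

(** Induction on the tail: prepending [tperm c1 c2] to the product [f] for [c1 :: c] inserts [c2]
    right after [c1], as [f] fixes [c2]. *)
Lemma fcycle_cycle_perm (T : finType) (c : seq T) :
  uniq c -> fcycle (cycle_perm c) c.
Proof.
case: c => // c1 c; elim: c => [|c2 c IHc]; first by rewrite /= big_nil perm1 eqxx.
rewrite /= inE negb_or -!andbA => /and4P[c12 c1c c2c Uc].
have /IHc /= {}IHc : uniq (c1 :: c) by rewrite /= c1c.
have f_c2 : cycle_perm (c1 :: c) c2 = c2.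
  by rewrite cycle_perm_out // inE negb_or eq_sym c12.
rewrite /= in f_c2; rewrite big_cons; set f := (\prod_(j <- c) _)%g in IHc f_c2 *.
rewrite permM tpermL f_c2 eqxx /=.
have g_f x : x != c1 -> x != c2 -> (tperm c1 c2 * f)%g x = f x.
  by move=> xc1 xc2; rewrite permM tpermD // eq_sym.
case: c c1c c2c Uc {f_c2} @f IHc g_f => [|c3 c] c1c c2c _ f /= IHc g_f.
  by rewrite permM tpermR.
move: IHc; rewrite permM tpermR => /andP[-> /=].
(* The two maps may differ at [c1], but [c1] is the endpoint of this path. *)
rewrite (@eq_fpath_rcons _ f (tperm c1 c2 * f)%g) //.
by move=> x xc; rewrite g_f //; [apply: contraNneq c1c | apply: contraNneq c2c] => <-.
Qed.

Lemma perm_of_cycles_out (T : finType) (s : seq (seq T)) (x : T) :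
  x \notin flatten s -> perm_of_cycles s x = x.
Proof.
rewrite /perm_of_cycles; elim: s => [|c s IHs] /=; first by rewrite big_nil perm1.
rewrite mem_cat negb_or big_cons permM => /andP[xc /IHs].
by rewrite cycle_perm_out.
Qed.

Lemma fcycle_perm_of_cycles (T : finType) (s : seq (seq T)) :
  uniq (flatten s) -> all (fcycle (perm_of_cycles s)) s.
Proof.
move=> Us; apply/allP => c cs.
suff [Uc eq_c] : uniq c /\ {in c, cycle_perm c =1 perm_of_cycles s}.
  by rewrite -(eq_fcycle_in _ _ _ _ eq_c) fcycle_cycle_perm.
rewrite /perm_of_cycles; elim: s Us cs => //= c' s IHs.
rewrite cat_uniq inE => /and3P[Uc' /hasPn sNc' /IHs {}IHs].
case: eqVneq => [-> _ | _ /= /[dup] cs /IHs[Uc eq_c]]; split=> // x xc.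
  rewrite big_cons permM -/(perm_of_cycles s) perm_of_cycles_out //.
  (* The image of [x] stays in [c']: outside [c'] it would be fixed by [cycle_perm c'], hence equal
     to [x] by injectivity. *)
  apply: contraL (xc) => /sNc' /= c'xN.
  by rewrite -(perm_inj (cycle_perm_out _ _ _ c'xN)).
rewrite big_cons permM (cycle_perm_out _ c') ?eq_c //; apply: sNc'.
by apply/flattenP; exists c.
Qed.

(** * Validity of the canonical notation *)

Lemma cycle_notation_neq0 (n : nat) (p : 'S_n) : [::] \notin cycle_notation p.
Proof.
by apply/mapP => -[i _]; rewrite /fingraph.orbit -orderSpred.
Qed.

Lemma fcycle_cycle_notation (n : nat) (p : 'S_n) : all (fcycle p) (cycle_notation p).
Proof.
by apply/allP => _ /mapP[i _ ->]; apply/cycle_orbit/perm_inj.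
Qed.

(** The filter keeps exactly one representative per orbit, its largest letter. *)
Lemma perm_flatten_cycle_notation (n : nat) (p : 'S_n) :
  perm_eq (flatten (cycle_notation p)) (enum 'I_n).
Proof.
apply: uniq_perm => [||x]; first 1 last.
- exact: enum_uniq.
- rewrite mem_enum; apply/flatten_mapP.
  have [i /= ix i_max] := @arg_maxnP _ x (fun y => y \in porbit p x) val (porbit_id p x).
  exists i; last by rewrite -porbit_orbit porbit_sym.
  rewrite mem_filter mem_rev mem_enum andbT; apply/forall_inP => j.
  by move: ix; rewrite -eq_porbit_mem => /eqP->; apply: i_max.
(* Seen as a dependent [allpairs], the list is duplicate-free once two kept representatives whose
   orbits share a letter coincide; each then bounds the other. *)
rewrite -[flatten _]map_id map_flatten -map_comp.
apply: (@allpairs_uniq_dep _ _ _ (fun _ y => y)).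
- by rewrite filter_uniq // rev_uniq enum_uniq.
- by move=> i _; apply: orbit_uniq.
move=> _ _ /allpairsPdep[i [x [i_max ix ->]]]
  /allpairsPdep[j [y [j_max jy ->]]] /= eq_xy.
rewrite -{}eq_xy in jy *; suff -> : i = j by [].
move: i_max j_max ix jy; rewrite !mem_filter -!porbit_orbit.
move=> /andP[/forall_inP i_max _] /andP[/forall_inP j_max _].
rewrite -!eq_porbit_mem => /eqP -> /eqP eq_ij.
by apply/val_inj/anti_leq; rewrite i_max ?j_max -?eq_ij ?porbit_id // eq_ij porbit_id.
Qed.

Theorem theorem4p4 (k n : nat) (k_gt0 : 0 < k) (n_gt0 : 1 <= n)
    (kNn : ~~ (k %| n)) (p : 'S_n.-1) (x : 'I_n) :
  num_cycles k p = num_cycles k (phi_perm k p x).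
Proof.
(* Since 1 divides every [n], the hypothesis excludes [k = 1]. *)
have k_gt1 : 1 < k by move: k_gt0 kNn; case: k => [|[]] //; rewrite dvd1n.
have perm_s := perm_flatten_cycle_notation _ p.
set t := map (map (lift x)) (cycle_notation p).
have flatten_t : flatten t = map (lift x) (flatten (cycle_notation p)).
  by rewrite map_flatten.
have t_neq0 : [::] \notin t.
  by apply/mapP => -[[|//]]; rewrite (negPf (cycle_notation_neq0 _ p)).
have size_t : (size (flatten t)).+1 = n.
  by rewrite flatten_t size_map (perm_size perm_s) size_enum_ord prednK.
have [/(_ x)[perm_phi phi_neq0] _] := phi_psi_perm_eq _ _ _ _ k_gt1 t_neq0.
have [count_phi _] := phi_psi_count _ _ _ _ k_gt1 t_neq0.
have Ux : uniq (x :: flatten t).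
  rewrite /= flatten_t map_inj_uniq ?(perm_uniq perm_s) ?enum_uniq ?andbT;
    last exact: lift_inj.
  by apply/mapP => -[y _ /eqP]; rewrite (negPf (neq_lift _ _)).
have Uphi : uniq (flatten (phi k t x)) by rewrite (perm_uniq perm_phi).
rewrite (num_cycles_count _ _ p (cycle_notation p)) ?cycle_notation_neq0
  ?fcycle_cycle_notation ?(perm_uniq perm_s) ?enum_uniq //; last first.
  by move=> i; rewrite (perm_mem perm_s) mem_enum.
rewrite (num_cycles_count _ _ _ (phi k t x)) ?fcycle_perm_of_cycles //; last first.
  move=> i; rewrite (perm_mem perm_phi) inE flatten_t.
  case: (unlift x i) / unliftP => [j|] ->.
    by rewrite mem_map ?(perm_mem perm_s) ?mem_enum ?orbT //; apply: lift_inj.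
  by rewrite eqxx.
(* The condition of [count_phi] concerns the letters of [t] plus one, that is [n]; relabelling by
   [lift x] keeps cycle lengths. *)
rewrite count_phi ?size_t // [count _ t]count_map.
by apply: eq_count => c; rewrite /= size_map.
Qed.
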